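(* Let $E\subset\mathbb{H}^n$ be a closed set. Take $p\notin E$ and $q\in E$ such that $\delta_E(p)=d(p,q)$. Let $\gamma:[0,\delta_E(p)]\to\mathbb{H}^n$ be a length-minimizing geodesic of curvature $\lambda$, parameterized by arc-length, with $\gamma(0)=q$ and $\gamma(\delta_E(p))=p$. Then: (i) $\dot\gamma(0)\in\operatorname{Nor}_H(E,q)$. (ii) The curvature $\lambda$ of the geodesic $\gamma$ lies in the interval $$\bigg[\sup_{\substack{v\in\operatorname{Tan}(E,q)\\ \langle v,T_q\rangle<0}}\frac{-2\langle v,\dot\gamma(0)\rangle}{\langle v,T_q\rangle},\ \inf_{\substack{v\in\operatorname{Tan}(E,q)\\ \langle v,T_q\rangle>0}}\frac{-2\langle v,\dot\gamma(0)\rangle}{\langle v,T_q\rangle}\bigg],$$ where the left quantity is replaced by $-\infty$ if $\langle v,T_q\rangle\ge 0$ for all $v\in\operatorname{Tan}(E,q)$, and the right quantity by $+\infty$ when $\langle v,T_q\rangle\le 0$ for all $v\in\operatorname{Tan}(E,q)$.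
   Context: $\mathbb{H}^n$ is $\mathbb{R}^{2n+1}$ with coordinates $(x_1,y_1,\ldots,x_n,y_n,t)$, with the left-invariant vector fields $X_i=\partial_{x_i}+y_i\partial_t$, $Y_i=\partial_{y_i}-x_i\partial_t$ ($1\le i\le n$), $T=\partial_t$, and $n\ge 1$. The horizontal distribution $\mathcal{H}$ is spanned by the $X_i,Y_i$; $\langle\cdot,\cdot\rangle$ is the Riemannian metric making $\{X_i,Y_i,T\}$ orthonormal; $J(X_i)=Y_i$, $J(Y_i)=-X_i$, $J(T)=0$. $\nabla$ is the pseudo-hermitian connection: the metric connection for which all $X_i,Y_i,T$ are parallel. $d$ is the Carnot-Carathéodory distance (infimum of Riemannian lengths of piecewise smooth curves tangent to $\mathcal{H}$); $\delta_E(p)=\inf\{d(p,q):q\in E\}$. A unit-speed geodesic of curvature $\lambda$ is a smooth horizontal unit-speed curve with $\nabla_{\dot\gamma}\dot\gamma+\lambda J(\dot\gamma)=0$; every length-minimizing curve parameterized by arc-length is of this form for a unique $\lambda\in\mathbb{R}$. The tangent cone $\operatorname{Tan}(E,q)\subset T_q\mathbb{H}^n$ is the closed positively homogeneous set composed of the zero vector and the limits of tangent vectors at $q$ of $C^1$ curves starting from $q$ and contained in $E$. $\operatorname{Tan}_H(E,q)=\operatorname{Tan}(E,q)\cap\mathcal{H}_q$ and $\operatorname{Nor}_H(E,q)=\{v\in\mathcal{H}_q:\langle v,u\rangle\le 0\text{ for all }u\in\operatorname{Tan}_H(E,q)\}$. *)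

(* Defs.v *)
From HB Require Import structures.
From mathcomp Require Import all_boot all_order all_algebra.
From mathcomp Require Import all_classical all_reals all_analysis.
Set Implicit Arguments.
Unset Strict Implicit.
Unset Printing Implicit Defensive.
Import Order.TTheory GRing.Theory Num.Theory.
Import numFieldNormedType.Exports.
Local Open Scope classical_set_scope.
Local Open Scope ring_scope.

Section RelativeDerivative.
Context {R : realType} {V : normedModType R}.

(* The derivative of f at s relative to [a, b]: it is one-sided at the end    *)
(* points, and the usual derivative inside.                                   *)
Definition diff_quot (f : R -> V) (s u : R) : V :=
  (u - s)^-1 *: (f u - f s).

Definition derivable_on (a b : R) (f : R -> V) (s : R) : Prop :=
  cvg (diff_quot f s @ within `[a, b] s^').

Definition deriv_on (a b : R) (f : R -> V) (s : R) : V :=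
  lim (diff_quot f s @ within `[a, b] s^').

Fixpoint Ck_on (k : nat) (a b : R) (f : R -> V) : Prop :=
  if k is k'.+1
  then (forall s, s \in `[a, b] -> derivable_on a b f s) /\
       Ck_on k' a b (deriv_on a b f)
  else {within `[a, b], continuous f}.

Definition smooth_on (a b : R) (f : R -> V) : Prop :=
  forall k, Ck_on k a b f.

End RelativeDerivative.

(* The space R^(2n+1), with the coordinates grouped as ((x, y), t).  It is    *)
(* used for the points of H^n, for the tangent vectors at a point (written in *)
(* the basis d/dx_i, d/dy_i, d/dt), and for the components of a tangent       *)
(* vector in the frame X_i, Y_i, T.                                           *)
Notation Heis R n := ('rV[R]_n * 'rV[R]_n * R)%type.

Section Frame.
Context {R : realType} {n : nat}.
Implicit Types (p q u v c : Heis R n).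

Definition hx p : 'rV[R]_n := p.1.1.
Definition hy p : 'rV[R]_n := p.1.2.
Definition ht p : R := p.2.

Definition vX (i : 'I_n) q : Heis R n := (delta_mx 0 i, 0, hy q 0 i).
Definition vY (i : 'I_n) q : Heis R n := (0, delta_mx 0 i, - hx q 0 i).
Definition vT q : Heis R n := (0, 0, 1).

Definition frame q c : Heis R n :=
  \sum_i hx c 0 i *: vX i q + \sum_i hy c 0 i *: vY i q + ht c *: vT q.

Definition coframe q v : Heis R n :=
  (hx v, hy v, ht v - \sum_i (hx v 0 i * hy q 0 i - hy v 0 i * hx q 0 i)).

Lemma frameE q c : frame q c =
  (hx c, hy c, ht c + \sum_i (hx c 0 i * hy q 0 i - hy c 0 i * hx q 0 i)).
Proof.
have sum3 (F : 'I_n -> Heis R n) : \sum_i F i =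
    (\sum_i hx (F i), \sum_i hy (F i), \sum_i ht (F i)).
  rewrite [LHS]surjective_pairing [X in (X, _)]surjective_pairing.
  congr (_, _, _); exact: (big_morph (fun v : Heis R n => _)).
rewrite /frame !sum3 /hx /hy /ht /=.
congr (_, _, _) => /=.
- rewrite scaler0 addr0 [X in _ + X]big1 ?addr0; last by move=> i _; rewrite scaler0.
  by rewrite [RHS]row_sum_delta.
- rewrite scaler0 addr0 big1 ?add0r; last by move=> i _; rewrite scaler0.
  by rewrite [RHS]row_sum_delta.
- rewrite /GRing.scale /= mulr1 addrC; congr (_ + _).
  by rewrite -big_split; apply: eq_bigr => i _; rewrite /= mulrN.
Qed.

Lemma frameK q : cancel (frame q) (coframe q).
Proof.
by move=> [[a b] c]; rewrite frameE /coframe /hx /hy /ht /= addrK.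
Qed.

Lemma coframeK q : cancel (coframe q) (frame q).
Proof.
by move=> [[a b] c]; rewrite frameE /coframe /hx /hy /ht /= subrK.
Qed.

(* The Riemannian metric at q for which X_i, Y_i, T are orthonormal.          *)
Definition inner q u v : R :=
  let a := coframe q u in let b := coframe q v in
  \sum_i hx a 0 i * hx b 0 i + \sum_i hy a 0 i * hy b 0 i + ht a * ht b.

Definition riem_norm q v : R := Num.sqrt (inner q v v).

Definition horizontal q v : Prop :=
  exists a b : 'rV[R]_n, v = \sum_i a 0 i *: vX i q + \sum_i b 0 i *: vY i q.

(* The linear map with J(X_i) = Y_i, J(Y_i) = - X_i and J(T) = 0.             *)
Definition J q v : Heis R n :=
  let a := coframe q v in
  \sum_i hx a 0 i *: vY i q - \sum_i hy a 0 i *: vX i q.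

(* The breakpoints are a = nth a (a :: s) 0 < nth a s 0 < ... < last a s = b. *)
Definition piecewise_smooth_horizontal (a b : R) (f : R -> Heis R n) : Prop :=
  {within `[a, b], continuous f} /\
  exists s : seq R, [/\ path <%R a s, last a s = b &
    forall i, (i < size s)%N ->
      let a' := nth a (a :: s) i in let b' := nth a s i in
      smooth_on a' b' f /\
      forall r, r \in `[a', b'] -> horizontal (f r) (deriv_on a' b' f r)].

(* For a piecewise smooth curve, the integrand is meaningful except at the    *)
(* finitely many breakpoints, which do not contribute to the integral.        *)
Definition curve_length (a b : R) (f : R -> Heis R n) : R :=
  (\int[lebesgue_measure]_(s in `[a, b]) riem_norm (f s) (deriv_on a b f s))%R.

Definition cc_dist p q : R :=
  inf [set l : R | exists a b (f : R -> Heis R n),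
    [/\ a < b, piecewise_smooth_horizontal a b f, f a = p, f b = q &
        l = curve_length a b f]].

Definition dist_to (E : set (Heis R n)) p : R := inf [set cc_dist p q | q in E].

Definition length_minimizing (a b : R) (f : R -> Heis R n) : Prop :=
  piecewise_smooth_horizontal a b f /\
  curve_length a b f = cc_dist (f a) (f b).

(* The covariant derivative along f of the vector field V along f, for the    *)
(* connection for which X_i, Y_i, T are parallel.                             *)
Definition cov_deriv (a b : R) (f V : R -> Heis R n) (s : R) : Heis R n :=
  frame (f s) (deriv_on a b (fun r => coframe (f r) (V r)) s).

Definition geodesic (lambda a b : R) (f : R -> Heis R n) : Prop :=
  smooth_on a b f /\
  forall s, s \in `[a, b] ->
    [/\ horizontal (f s) (deriv_on a b f s),
        riem_norm (f s) (deriv_on a b f s) = 1 &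
        cov_deriv a b f (deriv_on a b f) s +
          lambda *: J (f s) (deriv_on a b f s) = 0].

Definition curve_tangents (E : set (Heis R n)) q : set (Heis R n) :=
  [set v | exists (e : R) (f : R -> Heis R n),
    [/\ 0 < e, Ck_on 1 0 e f, f 0 = q,
        forall s, s \in `[0, e] -> E (f s) & v = deriv_on 0 e f 0]].

Definition Tan (E : set (Heis R n)) q : set (Heis R n) :=
  [set 0] `|` closure (curve_tangents E q).

Definition Tan_H (E : set (Heis R n)) q : set (Heis R n) :=
  Tan E q `&` [set v | horizontal q v].

Definition Nor_H (E : set (Heis R n)) q : set (Heis R n) :=
  [set v | horizontal q v /\ forall u, Tan_H E q u -> inner q v u <= 0].

End Frame.

(* Main.v *)
Require Import Defs.
From HB Require Import structures.
From mathcomp Require Import all_boot all_order all_algebra.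
From mathcomp Require Import all_classical all_reals all_analysis.
From mathcomp Require Import ring lra.
Set Implicit Arguments.
Unset Strict Implicit.
Unset Printing Implicit Defensive.
Import Order.TTheory GRing.Theory Num.Theory.
Import numFieldNormedType.Exports.
Local Open Scope classical_set_scope.
Local Open Scope ring_scope.

(** Both conclusions are consequences of one inequality, valid for every [v] in
   the tangent cone, where [w] is the initial velocity of the geodesic:

     <v, w> + (lambda / 2) <v, T> <= 0.

   For horizontal [v] it says that [w] is a normal vector; dividing it by
   [<v, T>] gives the bound on [lambda] from one side or the other according to
   the sign of [<v, T>]. As the left-hand side is continuous in [v], it is enough
   to treat the derivative [v] at [0] of a C^1 curve [f] in [E] starting at [q].

   The inequality is the first variation of length. Every point [f s] is at
   distance at least [d], the distance from [p] to [q], so a horizontal curve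
   from [p] to [f s] has length at least [d]. It remains to exhibit such curves
   of length at most [d - s (<v, w> + (lambda / 2) <v, T>) + o(s)].

   A horizontal curve is determined by its projection [z] to the plane R^(2n) and
   by its initial height, because horizontality means [t' = omega (z', z)] for the
   symplectic form [omega]; its length is the Euclidean length of [z]. Let [z] be
   the projection of the geodesic run backwards from [p] to [q]. The geodesic
   equation becomes [z'' = lambda J z'], where [J] is the rotation by a quarter
   turn. The projection is perturbed to

     z r + (r / d) a + b e(r) u,   e(r) = r (d - r) omega (z' r, u),

   where the first correction moves the end point by a prescribed vector [a]
   and the second one, which vanishes at both ends, adjusts the final height.
   With [u = J z'(d / 2)], the effect of [b] on the height is to first order
   [2 S b], where [S], the integral of [e omega (z', u)], is positive because the
   integrand is a nonnegative function times a square, and does not vanish at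
   the middle of the segment. The perturbation has a
   fixed shape, so that the final height depends on [a] and [b] through an
   explicit expression, and prescribing it amounts to a linear equation for [b].

   Since [z] has unit speed, the length is at most the integral of the mean of
   [1] and of the squared speed (the square root is below its tangent at [1]).
   This upper bound has the same first order terms as the length, and an explicit
   primitive: the geodesic equation makes [lambda] times the change of height
   appear in it. [cc_dist_variation] states the resulting bound on the distance,
   and [first_variation_limit] divides it by [s] and lets [s] tend to [0].

   Velocities of curves parameterized by a segment are relative derivatives,
   one-sided at the end points; they obey the usual rules of calculus. *)

(** * Derivatives relative to a segment *)

Section RelativeDerivativeCalculus.
Context {R : realType} {a b : R} (ab : a < b).
Implicit Types (V W : normedModType R) (s : R).

(** A relation between a function and its derivative, rather than a derivative
   picked by [lim], lets existence and value be proved in one step. *)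
Definition has_deriv_on {V} (f : R -> V) s (l : V) : Prop :=
  diff_quot f s @ within `[a, b] s^' --> l.

Lemma within_itv_proper s : s \in `[a, b] -> ProperFilter (within `[a, b] s^').
Proof.
rewrite in_itv /= => /andP[as_ sb]; apply: Build_ProperFilter_ex => P [e /= e0 eP].
have [sb'|sb'] := ltP s b.
- pose u := s + Num.min (e / 2) (b - s).
  have m0 : 0 < Num.min (e / 2) (b - s) by rewrite lt_min divr_gt0 //= subr_gt0.
  exists u; apply: eP; rewrite /ball_ /= /u.
  + rewrite opprD addrA subrr sub0r normrN gtr0_norm // gt_min.
    by rewrite ltr_pdivrMr // ltr_pMr // ltr1n.
  + by rewrite eq_sym lt_eqF // ltrDl.
  + rewrite in_itv /= (le_trans as_) ?lerDl ?(ltW m0) //=.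
    by rewrite -lerBrDl ge_min lexx orbT.
- have sa : a < s by exact: lt_le_trans ab sb'.
  pose u := s - Num.min (e / 2) (s - a).
  have m0 : 0 < Num.min (e / 2) (s - a) by rewrite lt_min divr_gt0 //= subr_gt0.
  exists u; apply: eP; rewrite /ball_ /= /u.
  + rewrite opprB addrC subrK gtr0_norm // gt_min.
    by rewrite ltr_pdivrMr // ltr_pMr // ltr1n.
  + by rewrite lt_eqF // ltrBlDr ltrDl.
  + rewrite in_itv /= lerBrDr -lerBrDl ge_min lexx orbT /=.
    by rewrite (le_trans _ sb) // gerBl ltW.
Qed.

Lemma deriv_onE V (f : R -> V) s l : s \in `[a, b] ->
  has_deriv_on f s l -> deriv_on a b f s = l.
Proof. by move=> /within_itv_proper Fs /cvg_lim; apply. Qed.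

Lemma within_itvW s (P : set R) : (forall u, u \in `[a, b] -> u != s -> P u) ->
  \forall u \near within `[a, b] s^', P u.
Proof.
move=> h; rewrite near_withinE; apply: filterS (nbhs_dnbhs_neq s) => u us uab.
exact: h.
Qed.

Lemma eq_has_deriv_on V (f g : R -> V) s l : s \in `[a, b] ->
  (forall u, u \in `[a, b] -> f u = g u) ->
  has_deriv_on f s l -> has_deriv_on g s l.
Proof.
move=> sab fg; apply: cvg_trans; apply: near_eq_cvg.
by apply: within_itvW => u uab _; rewrite /diff_quot !fg.
Qed.

Lemma within_cvg_id s : (fun u => u) @ within `[a, b] s^' --> s.
Proof. by move=> P sP; apply: cvg_within; exact: nbhs_dnbhs. Qed.

(** The increment [f u - f s] is the product of [u - s], which tends to [0], and
   of a difference quotient that has a limit. *)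
Lemma has_deriv_on_cvg V (f : R -> V) s l :
  has_deriv_on f s l -> f @ within `[a, b] s^' --> f s.
Proof.
move=> fl.
have h : (fun u => (u - s) *: diff_quot f s u + f s) @ within `[a, b] s^' --> f s.
  rewrite -[X in _ --> X]add0r -[X in _ --> X + _](scale0r l).
  apply: cvgD; last exact: cvg_cst.
  apply: cvgZ fl; rewrite -(subrr s); apply: cvgB; first exact: within_cvg_id.
  exact: cvg_cst.
apply: cvg_trans h; apply: near_eq_cvg; apply: within_itvW => u _ us.
by rewrite /diff_quot scalerA divff ?subr_eq0 // scale1r subrK.
Qed.

Lemma within_continuousP V (f : R -> V) :
  (forall s, s \in `[a, b] -> f @ within `[a, b] s^' --> f s) <->
  {within `[a, b], continuous f}.
Proof.
split=> [h|/subspace_continuousP h s sab].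
  apply/subspace_continuousP => s sab P fP.
  have H : \forall u \near s, u != s -> u \in `[a, b] -> P (f u) := h s sab P fP.
  change (\forall u \near s, u \in `[a, b] -> P (f u)).
  apply: filterS H => u; have [->|us H uab] := eqVneq u s; last exact: H.
  by move=> _ _; exact: nbhs_singleton.
move=> P fP.
have H : \forall u \near s, u \in `[a, b] -> P (f u) := h s sab P fP.
change (\forall u \near s, u != s -> u \in `[a, b] -> P (f u)).
by apply: filterS H => u + _.
Qed.

Lemma has_deriv_on_continuous V (f f' : R -> V) :
  (forall s, s \in `[a, b] -> has_deriv_on f s (f' s)) ->
  {within `[a, b], continuous f}.
Proof. by move=> h; apply/within_continuousP => s /h/has_deriv_on_cvg. Qed.

Lemma has_deriv_on_cst V (c : V) s : has_deriv_on (fun=> c) s 0.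
Proof.
rewrite /has_deriv_on (_ : diff_quot _ _ = fun=> 0); first exact: cvg_cst.
by apply/funext => u; rewrite /diff_quot subrr scaler0.
Qed.

Lemma has_deriv_on_id s : has_deriv_on (fun r : R => r) s 1.
Proof.
have h : (fun=> 1 : R) @ within `[a, b] s^' --> (1 : R) by exact: cvg_cst.
apply: cvg_trans h; apply: near_eq_cvg; apply: within_itvW => u _ us.
by rewrite /diff_quot /GRing.scale /= mulVf // subr_eq0.
Qed.

Lemma has_deriv_onD V (f g : R -> V) s l m :
  has_deriv_on f s l -> has_deriv_on g s m ->
  has_deriv_on (fun r => f r + g r) s (l + m).
Proof.
move=> fl gm; rewrite /has_deriv_on (_ : diff_quot _ _ =
  fun u => diff_quot f s u + diff_quot g s u); first exact: cvgD.
by apply/funext => u; rewrite /diff_quot -scalerDr opprD addrACA.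
Qed.

Lemma has_deriv_on_sum V (I : Type) (r : seq I) (f : I -> R -> V) s l :
  (forall i, has_deriv_on (f i) s (l i)) ->
  has_deriv_on (fun u => \sum_(i <- r) f i u) s (\sum_(i <- r) l i).
Proof.
move=> fl; elim: r => [|i r IH].
  under eq_fun do rewrite big_nil; rewrite big_nil; exact: has_deriv_on_cst.
under eq_fun do rewrite big_cons; rewrite big_cons; exact: has_deriv_onD.
Qed.

Lemma has_deriv_onZ V (k : R -> R) (f : R -> V) s c l :
  has_deriv_on k s c -> has_deriv_on f s l ->
  has_deriv_on (fun r => k r *: f r) s (c *: f s + k s *: l).
Proof.
move=> kc fl; rewrite /has_deriv_on (_ : diff_quot _ _ =
  fun u => diff_quot k s u *: f u + k s *: diff_quot f s u).
  apply: cvgD; first by apply: cvgZ kc _; exact: has_deriv_on_cvg fl.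
  exact: cvgZl_tmp.
apply/funext => u; rewrite /diff_quot.
rewrite scalerA [k s * _]mulrC -!scalerA -scalerDr; congr (_ *: _).
by rewrite scalerBl scalerBr addrA subrK.
Qed.

Lemma has_deriv_onM (f g : R -> R) s l m :
  has_deriv_on f s l -> has_deriv_on g s m ->
  has_deriv_on (fun r => f r * g r) s (l * g s + f s * m).
Proof. exact: has_deriv_onZ. Qed.

Lemma has_deriv_on_comp_linear V W (phi : V -> W) (f : R -> V) s l :
  linear phi -> continuous phi ->
  has_deriv_on f s l -> has_deriv_on (fun r => phi (f r)) s (phi l).
Proof.
move=> phil phic fl; rewrite /has_deriv_on (_ : diff_quot _ _ = phi \o diff_quot f s).
  exact: cvg_comp fl (phic l).
have phi0 : phi 0 = 0.
  by have := phil (-1) 0 0; rewrite scaler0 addr0 scaleN1r addNr.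
apply/funext => u; rewrite /diff_quot /= -[_ *: (f u - f s)]addr0 phil phi0 addr0.
by rewrite -[- f s]scaleN1r [f u + _]addrC phil scaleN1r addrC.
Qed.

End RelativeDerivativeCalculus.
Arguments has_deriv_on {R} a b {V}.

(** * Mean values and primitives *)

Section MeanValueAndIntegration.
Context {R : realType} {a b : R} (ab : a < b).
Implicit Types (F G f g : R -> R) (s : R).

Lemma within_cvg_reflect s :
  (fun u => a + b - u) @ within `[a, b] s^' --> within `[a, b] (a + b - s)^'.
Proof.
have c : {for s, continuous (fun u : R => a + b - u)}.
  by rewrite /prop_for /continuous_at; apply: cvgB; [exact: cvg_cst|exact: cvg_id].
move=> P; rewrite /within /= => HP.
have := c _ HP.
change ((\forall u \near s, a + b - u != a + b - s -> a + b - u \in `[a, b] ->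
      P (a + b - u)) -> \forall u \near s, u != s -> u \in `[a, b] -> P (a + b - u)).
apply: filterS => u H us.
rewrite in_itv /= => /andP[au ub]; apply: H.
- by apply: contra_neq us => /(addrI _)/oppr_inj.
- by rewrite in_itv /=; apply/andP; split; lra.
Qed.

Lemma has_deriv_on_reflect (V : normedModType R) (f : R -> V) s l :
  has_deriv_on a b f (a + b - s) l ->
  has_deriv_on a b (fun r => f (a + b - r)) s (- l).
Proof.
move=> fl; rewrite /has_deriv_on (_ : diff_quot _ _ =
  fun u => - diff_quot f (a + b - s) (a + b - u)).
  by apply: cvgN; exact: cvg_comp (@within_cvg_reflect s) fl.
apply/funext => u; rewrite /diff_quot -scaleNr -invrN; congr (_^-1 *: _).
by ring.
Qed.

Lemma has_deriv_on_is_derive F s l : s \in `]a, b[ ->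
  has_deriv_on a b F s l -> is_derive s 1 F l.
Proof.
move=> sab Fl.
have h : (fun h => h^-1 *: (F (h *: 1 + s) - F s)) @ 0^' --> l.
  rewrite (_ : (fun _ => _) = diff_quot F s \o (fun h => h + s)); last first.
    by apply/funext => h; rewrite /diff_quot /= addrK [h *: 1]mulr1.
  suff hs : (fun h => h + s) @ 0^' --> within `[a, b] s^' by exact: cvg_comp hs Fl.
  move=> P HP.
  have c : {for 0, continuous (fun h : R => h + s)}.
    by rewrite /prop_for /continuous_at; apply: cvgD; [exact: cvg_id|exact: cvg_cst].
  have sE : 0 + s = s by rewrite add0r.
  have Hin : \forall u \near s, u \in `]a, b[ by exact: near_in_itvoo.
  have HP' : \forall u \near 0 + s, u != s -> u \in `[a, b] -> P u.
    by rewrite sE; exact: HP.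
  have Hin' : \forall u \near 0 + s, u \in `]a, b[.
    by rewrite sE; exact: Hin.
  have H1 : \forall h \near (0 : R), h + s != s -> h + s \in `[a, b] -> P (h + s) :=
    c _ HP'.
  have H2 : \forall h \near (0 : R), h + s \in `]a, b[ := c _ Hin'.
  change (\forall h \near (0 : R), h != 0 -> P (h + s)).
  apply: filterS2 H1 H2 => h H hab h0; apply: H.
    by rewrite -subr_eq0 addrK.
  exact: subset_itv_oo_cc hab.
apply: DeriveDef; first by apply/cvg_ex; exists l.
by rewrite /derive; apply: cvg_lim h.
Qed.

Lemma is_derive_has_deriv_on F s l :
  is_derive s 1 F l -> has_deriv_on a b F s l.
Proof.
case=> /cvg_ex[l' /= Fl'] El.
have {}El : l = l' by rewrite -El; exact: cvg_lim Fl'.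
rewrite /has_deriv_on (_ : diff_quot F s =
  (fun h => h^-1 *: (F (h *: 1 + s) - F s)) \o (fun u => u - s)); last first.
  by apply/funext => u; rewrite /diff_quot /= [(u - s) *: 1]mulr1 subrK.
rewrite El.
suff hs : (fun u => u - s) @ within `[a, b] s^' --> 0^' by exact: cvg_comp hs Fl'.
move=> P HP.
have c : {for s, continuous (fun u : R => u - s)}.
  by rewrite /prop_for /continuous_at; apply: cvgB; [exact: cvg_id|exact: cvg_cst].
have HP' : \forall h \near s - s, h != 0 -> P h.
  by rewrite subrr; exact: HP.
have := c _ HP'.
change ((\forall u \near s, (u - s != 0 -> P (u - s)))
    -> \forall u \near s, u != s -> u \in `[a, b] -> P (u - s)).
by apply: filterS => u H us _; apply: H; rewrite subr_eq0.
Qed.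

(** Inside the segment the relative derivative is the usual one, and it gives
   continuity up to the end points, so the usual mean value theorem applies. *)
Lemma has_deriv_on_mean_value F F' :
  (forall s, s \in `[a, b] -> has_deriv_on a b F s (F' s)) ->
  forall x y, a <= x -> x <= y -> y <= b ->
  exists2 c, c \in `[a, b] & F y - F x = F' c * (y - x).
Proof.
move=> dF x y ax xy yb.
have sub : `[x, y] `<=` `[a, b].
  by move=> u /=; rewrite !in_itv /= => /andP[xu uy];
     rewrite (le_trans ax) // (le_trans uy).
have [] := @MVT_segment _ F F' x y xy.
- move=> c; rewrite in_itv /= => /andP[xc cy].
  apply: has_deriv_on_is_derive.
    by rewrite in_itv /= (le_lt_trans ax) // (lt_le_trans cy).
  by apply: dF; rewrite in_itv /= (le_trans ax) ?(ltW xc) //= (le_trans (ltW cy)).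
- apply: continuous_subspaceW sub _; exact: has_deriv_on_continuous dF.
- by move=> c cxy E; exists c => //; exact: sub.
Qed.

Lemma has_deriv_on_le F F' G G' :
  (forall s, s \in `[a, b] -> has_deriv_on a b F s (F' s)) ->
  (forall s, s \in `[a, b] -> has_deriv_on a b G s (G' s)) ->
  (forall s, s \in `[a, b] -> F' s <= G' s) -> F b - F a <= G b - G a.
Proof.
move=> dF dG FG.
have d s : s \in `[a, b] ->
    has_deriv_on a b (fun r => G r + (-1) *: F r) s (G' s - F' s).
  move=> sab; apply: has_deriv_onD; first exact: dG.
  have -> : - F' s = 0 *: F s + (-1) *: F' s by rewrite scale0r add0r scaleN1r.
  by apply: has_deriv_onZ; [exact: has_deriv_on_cst|exact: dF].
have [c cab] := has_deriv_on_mean_value d (lexx a) (ltW ab) (lexx b).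
rewrite !scaleN1r -subr_ge0 => E.
have -> : G b - G a - (F b - F a) = (G b - F b) - (G a - F a) by ring.
by rewrite E mulr_ge0 // subr_ge0 ?FG // ltW.
Qed.

(** A nondecreasing function with equal values at the end points is constant,
   which a single nonzero derivative forbids. *)
Lemma has_deriv_on_lt F F' c :
  (forall s, s \in `[a, b] -> has_deriv_on a b F s (F' s)) ->
  (forall s, s \in `[a, b] -> 0 <= F' s) ->
  c \in `[a, b] -> 0 < F' c -> F a < F b.
Proof.
move=> dF F0 cab Fc; rewrite ltNge; apply/negP => Fba.
have mono x y : a <= x -> x <= y -> y <= b -> F x <= F y.
  move=> ax xy yb; have [d dab] := has_deriv_on_mean_value dF ax xy yb.
  by rewrite -subr_ge0 => ->; rewrite mulr_ge0 ?F0 // subr_ge0.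
have FE u : u \in `[a, b] -> F u = F a.
  rewrite in_itv /= => /andP[au ub]; apply/eqP.
  by rewrite eq_le (le_trans (mono u b au ub (lexx b)) Fba) mono.
have := deriv_onE ab cab (eq_has_deriv_on cab FE (dF c cab)).
by rewrite (deriv_onE ab cab (has_deriv_on_cst _ _)) => E; rewrite -E ltxx in Fc.
Qed.

(** Precomposing with the projection of the line onto [[a, b]] makes the
   integrand continuous on the whole line, so that the fundamental theorem of
   calculus applies at the end points too. *)
Lemma antiderivative_ex f : {within `[a, b], continuous f} ->
  exists2 F, F a = 0 & forall s, s \in `[a, b] -> has_deriv_on a b F s (f s).
Proof.
move=> cf; pose clamp (x : R) := Num.max a (Num.min b x).
have clampab x : clamp x \in `[a, b].
  by rewrite in_itv /= le_max lexx /= ge_max (ltW ab) ge_min lexx.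
have clampE x : x \in `[a, b] -> clamp x = x.
  by rewrite in_itv /= /clamp => /andP[ax xb]; rewrite min_r // max_r.
have cclamp : continuous clamp.
  move=> x; apply: continuous_max; first exact: cvg_cst.
  by apply: continuous_min; [exact: cvg_cst|exact: cvg_id].
have cg : continuous (f \o clamp).
  move=> x P HP.
  have H : \forall u \near clamp x, u \in `[a, b] -> P (f u).
    by have /subspace_continuousP := cf; apply => //; exact: clampab.
  have {}H : \forall u \near x, clamp u \in `[a, b] -> P (f (clamp u)) :=
    cclamp x _ H.
  change (\forall u \near x, P (f (clamp u))).
  by apply: filterS H => u; apply; exact: clampab.
pose F (x : R) := (\int[lebesgue_measure]_(t in `[(a - 1)%R, x]) (f \o clamp) t)%R.
exists (fun x => F x - F a) => [|s sab]; first by rewrite subrr.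
have -> : f s = f (clamp s) + 0 by rewrite clampE // addr0.
apply: has_deriv_onD; last exact: has_deriv_on_cst.
apply: is_derive_has_deriv_on.
move: (sab); rewrite in_itv /= => /andP[as_ sb].
have [||||dF EF] := @continuous_FTC1_closed R (f \o clamp) (a - 1) s (b + 1).
- by rewrite (le_lt_trans sb) // ltrDl.
- apply: continuous_compact_integrable; first exact: segment_compact.
  exact: continuous_subspaceT.
- by rewrite ltrBlDr (le_lt_trans as_) // ltrDl.
- exact: cg.
- by apply: DeriveDef => //; rewrite -derive1E EF.
Qed.

(** This turns a length into the increase of a primitive, after which lengths
   are compared through derivatives alone, by [has_deriv_on_le]. *)
Lemma has_deriv_on_Rintegral F f : {within `[a, b], continuous f} ->
  (forall s, s \in `[a, b] -> has_deriv_on a b F s (f s)) ->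
  (\int[lebesgue_measure]_(s in `[a, b]) f s)%R = F b - F a.
Proof.
move=> cf dF.
have cF : {within `[a, b], continuous F} by exact: has_deriv_on_continuous dF.
have dF' s : s \in `]a, b[ -> is_derive s 1 F (f s).
  by move=> sab; apply: has_deriv_on_is_derive => //; apply: dF;
     exact: subset_itv_oo_cc sab.
rewrite /Rintegral (@continuous_FTC2 _ f F a b ab cf).
- by rewrite -EFinB.
- have [_ Fa Fb] := (continuous_within_itvP F ab).1 cF.
  by split => // s /dF'[].
- by move=> s /dF' ds; rewrite derive1E derive_val.
Qed.

End MeanValueAndIntegration.

(** * Closure properties of smooth functions *)

Section SmoothFunctions.
Context {R : realType} {a b : R} (ab : a < b).
Implicit Types (V W : normedModType R) (s : R).

(** Values off the segment do not matter, although [deriv_on] may be arbitrary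
   there. *)
Lemma eq_Ck_on V k (f g : R -> V) : (forall s, s \in `[a, b] -> f s = g s) ->
  Ck_on k a b f -> Ck_on k a b g.
Proof.
elim: k f g => [|k IH] f g fg /=.
  by apply: subspace_eq_continuous => s; rewrite inE => /fg.
have dfg s : s \in `[a, b] -> has_deriv_on a b f s (deriv_on a b f s) ->
    has_deriv_on a b g s (deriv_on a b f s).
  by move=> sab; apply: eq_has_deriv_on.
move=> [df cf]; split=> [s sab|].
  by apply/cvg_ex; exists (deriv_on a b f s); apply: dfg => //; apply: df.
apply: IH cf => s sab; apply/esym/(deriv_onE ab sab); apply: dfg => //.
exact: df.
Qed.

(** Smoothness can be read on any function agreeing on the segment with the
   derivative, which spares the computation of [deriv_on]. *)
Lemma Ck_onS V k (f f' : R -> V) :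
  (forall s, s \in `[a, b] -> has_deriv_on a b f s (f' s)) ->
  Ck_on k a b f' -> Ck_on k.+1 a b f.
Proof.
move=> df cf'; split=> [s sab|].
  by apply/cvg_ex; exists (f' s); exact: df.
by apply: eq_Ck_on cf' => s sab; apply/esym/(deriv_onE ab sab); exact: df.
Qed.

Lemma Ck_on_has_deriv_on V k (f : R -> V) s : Ck_on k.+1 a b f ->
  s \in `[a, b] -> has_deriv_on a b f s (deriv_on a b f s).
Proof. by move=> [df _] /df. Qed.

Lemma Ck_onW V k (f : R -> V) : Ck_on k.+1 a b f -> Ck_on k a b f.
Proof.
elim: k f => [|k IH] f cf.
  by apply: has_deriv_on_continuous => s; apply: Ck_on_has_deriv_on cf.
by split; [case: cf | apply: IH; case: cf].
Qed.

Lemma Ck_on_cst V k (c : V) : Ck_on k a b (fun=> c).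
Proof.
elim: k c => [|k IH] c.
  by apply: has_deriv_on_continuous => s _; exact: has_deriv_on_cst.
by apply: Ck_onS (IH 0) => s _; exact: has_deriv_on_cst.
Qed.

Lemma Ck_on_id k : Ck_on k a b (fun r : R => r).
Proof.
apply: Ck_onW; apply: (@Ck_onS R k id (fun=> 1)); last exact: Ck_on_cst.
by move=> s _; exact: has_deriv_on_id.
Qed.

Lemma Ck_onD V k (f g : R -> V) :
  Ck_on k a b f -> Ck_on k a b g -> Ck_on k a b (fun r => f r + g r).
Proof.
elim: k f g => [|k IH] f g cf cg.
  by move=> s; apply: cvgD; [exact: cf|exact: cg].
apply: (Ck_onS (f' := fun r => deriv_on a b f r + deriv_on a b g r)).
  by move=> s sab; apply: has_deriv_onD;
     [exact: Ck_on_has_deriv_on cf sab|exact: Ck_on_has_deriv_on cg sab].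
by apply: IH; [case: cf|case: cg].
Qed.

Lemma Ck_onZ V k (c : R -> R) (f : R -> V) :
  Ck_on k a b c -> Ck_on k a b f -> Ck_on k a b (fun r => c r *: f r).
Proof.
elim: k c f => [|k IH] c f cc cf.
  by move=> s; apply: cvgZ; [exact: cc|exact: cf].
apply: (Ck_onS (f' := fun r => deriv_on a b c r *: f r + c r *: deriv_on a b f r)).
  by move=> s sab; apply: has_deriv_onZ;
     [exact: Ck_on_has_deriv_on cc sab|exact: Ck_on_has_deriv_on cf sab].
apply: Ck_onD; apply: IH.
- by case: cc.
- exact: Ck_onW.
- exact: Ck_onW.
- by case: cf.
Qed.

Lemma Ck_on_comp_linear V W k (phi : V -> W) (f : R -> V) :
  linear phi -> continuous phi ->
  Ck_on k a b f -> Ck_on k a b (fun r => phi (f r)).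
Proof.
move=> phil phic; elim: k f => [|k IH] f cf.
  by move=> s; apply: continuous_comp; [exact: cf|exact: phic].
apply: (Ck_onS (f' := fun r => phi (deriv_on a b f r))).
  by move=> s sab; apply: has_deriv_on_comp_linear => //;
     apply: Ck_on_has_deriv_on cf sab.
by apply: IH; case: cf.
Qed.

Lemma itv_reflect s : s \in `[a, b] -> a + b - s \in `[a, b].
Proof. by rewrite !in_itv /= => /andP[as_ sb]; apply/andP; split; lra. Qed.

Lemma Ck_on_reflect V k (f : R -> V) :
  Ck_on k a b f -> Ck_on k a b (fun r => f (a + b - r)).
Proof.
elim: k f => [|k IH] f cf.
  apply/within_continuousP => s sab.
  have cfs : f @ within `[a, b] (a + b - s)^' --> f (a + b - s).
    by apply: ((within_continuousP f).2 cf); exact: itv_reflect.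
  exact: cvg_comp (@within_cvg_reflect _ _ _ s) cfs.
apply: (Ck_onS (f' := fun r => (-1) *: deriv_on a b f (a + b - r))).
  move=> s sab; rewrite scaleN1r; apply: has_deriv_on_reflect.
  by apply: Ck_on_has_deriv_on cf _; exact: itv_reflect.
by apply: Ck_onZ; [exact: Ck_on_cst|apply: IH; case: cf].
Qed.

Lemma smooth_onS V (f f' : R -> V) :
  (forall s, s \in `[a, b] -> has_deriv_on a b f s (f' s)) ->
  smooth_on a b f' -> smooth_on a b f.
Proof. by move=> df sf' k; apply: Ck_onW; apply: Ck_onS df (sf' k). Qed.

Lemma smooth_on_deriv_on V (f : R -> V) :
  smooth_on a b f -> smooth_on a b (deriv_on a b f).
Proof. by move=> sf k; case: (sf k.+1). Qed.

Lemma smooth_on_has_deriv_on V (f : R -> V) s : smooth_on a b f ->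
  s \in `[a, b] -> has_deriv_on a b f s (deriv_on a b f s).
Proof. by move=> sf; exact: Ck_on_has_deriv_on (sf 1). Qed.

Lemma smooth_onD V (f g : R -> V) : smooth_on a b f -> smooth_on a b g ->
  smooth_on a b (fun r => f r + g r).
Proof. by move=> sf sg k; exact: Ck_onD. Qed.

Lemma smooth_onZ V (c : R -> R) (f : R -> V) : smooth_on a b c ->
  smooth_on a b f -> smooth_on a b (fun r => c r *: f r).
Proof. by move=> sc sf k; exact: Ck_onZ. Qed.

Lemma smooth_onM (f g : R -> R) : smooth_on a b f ->
  smooth_on a b g -> smooth_on a b (fun r => f r * g r).
Proof. exact: smooth_onZ. Qed.

Lemma smooth_on_cst V (c : V) : smooth_on a b (fun=> c).
Proof. by move=> k; exact: Ck_on_cst. Qed.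

End SmoothFunctions.

(** * The symplectic plane under the Heisenberg group *)

Notation Plane R n := ('rV[R]_n * 'rV[R]_n)%type.

Section HorizontalPlane.
Context {R : realType} {n : nat}.
Implicit Types (z w : Plane R n) (p q v : Heis R n) (c : R).

Definition dot z w : R := \sum_i (z.1 0 i * w.1 0 i + z.2 0 i * w.2 0 i).

(** The endomorphism J of the horizontal distribution, in planar coordinates. *)
Definition rot90 z : Plane R n := (- z.2, z.1).

(** The symplectic form of R^(2n), written with [dot] to inherit its
   bilinearity, continuity and product rule. *)
Definition omega z w : R := dot (rot90 z) w.

Lemma dotC z w : dot z w = dot w z.
Proof. by apply: eq_bigr => i _; rewrite mulrC [X in _ + X]mulrC. Qed.

Lemma dotDl z1 z2 w : dot (z1 + z2) w = dot z1 w + dot z2 w.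
Proof. by rewrite -big_split; apply: eq_bigr => i _ /=; rewrite !mxE; ring. Qed.

Lemma dotZl c z w : dot (c *: z) w = c * dot z w.
Proof. by rewrite mulr_sumr; apply: eq_bigr => i _ /=; rewrite !mxE; ring. Qed.

Lemma dotDr z w1 w2 : dot z (w1 + w2) = dot z w1 + dot z w2.
Proof. by rewrite dotC dotDl !(dotC z). Qed.

Lemma dotZr c z w : dot z (c *: w) = c * dot z w.
Proof. by rewrite dotC dotZl dotC. Qed.

Lemma dot0r z : dot z 0 = 0.
Proof. by rewrite -(scale0r (0 : Plane R n)) dotZr mul0r. Qed.

Lemma dot_ge0 z : 0 <= dot z z.
Proof. by apply: sumr_ge0 => i _; rewrite addr_ge0 // -expr2 sqr_ge0. Qed.

Lemma omegaE z w : omega z w = \sum_i (z.1 0 i * w.2 0 i - z.2 0 i * w.1 0 i).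
Proof. by apply: eq_bigr => i _; rewrite !mxE /=; ring. Qed.

Lemma omegaC z w : omega z w = - omega w z.
Proof. by rewrite !omegaE -sumrN; apply: eq_bigr => i _; ring. Qed.

Lemma rot90_is_linear : linear rot90.
Proof.
by move=> c z w; apply: injective_projections; rewrite /= ?opprD ?scalerN.
Qed.

Lemma rot90Z c z : rot90 (c *: z) = c *: rot90 z.
Proof. by apply: injective_projections => //=; rewrite scalerN. Qed.

Lemma omegaDl z1 z2 w : omega (z1 + z2) w = omega z1 w + omega z2 w.
Proof. by rewrite /omega -dotDl -[z1 in LHS]scale1r rot90_is_linear scale1r. Qed.

Lemma omegaZl c z w : omega (c *: z) w = c * omega z w.
Proof.
by rewrite omegaC [in RHS]omegaC mulrN /omega dotZr.
Qed.

Lemma omegaDr z w1 w2 : omega z (w1 + w2) = omega z w1 + omega z w2.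
Proof. exact: dotDr. Qed.

Lemma omegaZr c z w : omega z (c *: w) = c * omega z w.
Proof. exact: dotZr. Qed.

Lemma omega_self z : omega z z = 0.
Proof. by have := omegaC z z; lra. Qed.

Lemma omega_rot90 z : omega z (rot90 z) = dot z z.
Proof. by rewrite omegaE; apply: eq_bigr => i _ /=; rewrite !mxE; ring. Qed.

Lemma fst_continuous {U V : topologicalType} : continuous (@fst U V).
Proof. by move=> p; exact: cvg_fst. Qed.

Lemma snd_continuous {U V : topologicalType} : continuous (@snd U V).
Proof. by move=> p; exact: cvg_snd. Qed.

Lemma rot90_continuous : continuous rot90.
Proof.
move=> z.
have h1 : (fun z : Plane R n => - z.2) @ z --> - z.2 by apply: cvgN; exact: cvg_snd.
have h2 : (fun z : Plane R n => z.1) @ z --> z.1 by exact: cvg_fst.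
exact: (cvg_pair h1 h2).
Qed.

Lemma cvg_dot (T : Type) (F : set_system T) (f g : T -> Plane R n) z w :
  Filter F -> f @ F --> z -> g @ F --> w ->
  (fun t => dot (f t) (g t)) @ F --> dot z w.
Proof.
move=> FF fz gw.
have c1 i : continuous (fun p : Plane R n => p.1 0 i).
  move=> p; apply: (@continuous_comp _ _ _ fst (fun M : 'rV[R]_n => M 0 i)).
    exact: fst_continuous.
  exact: coord_continuous.
have c2 i : continuous (fun p : Plane R n => p.2 0 i).
  move=> p; apply: (@continuous_comp _ _ _ snd (fun M : 'rV[R]_n => M 0 i)).
    exact: snd_continuous.
  exact: coord_continuous.
have f1 i : (fun t => (f t).1 0 i) @ F --> z.1 0 i.
  by apply: (@cvg_comp _ _ _ f (fun p : Plane R n => p.1 0 i) _ _ _ fz); exact: c1.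
have f2 i : (fun t => (f t).2 0 i) @ F --> z.2 0 i.
  by apply: (@cvg_comp _ _ _ f (fun p : Plane R n => p.2 0 i) _ _ _ fz); exact: c2.
have g1 i : (fun t => (g t).1 0 i) @ F --> w.1 0 i.
  by apply: (@cvg_comp _ _ _ g (fun p : Plane R n => p.1 0 i) _ _ _ gw); exact: c1.
have g2 i : (fun t => (g t).2 0 i) @ F --> w.2 0 i.
  by apply: (@cvg_comp _ _ _ g (fun p : Plane R n => p.2 0 i) _ _ _ gw); exact: c2.
apply: cvg_big => [|i _]; first exact: add_continuous.
apply: cvgD.
  exact: (cvgM (f1 i) (g1 i)).
exact: (cvgM (f2 i) (g2 i)).
Qed.

Lemma cvg_omega (T : Type) (F : set_system T) (f g : T -> Plane R n) z w :
  Filter F -> f @ F --> z -> g @ F --> w ->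
  (fun t => omega (f t) (g t)) @ F --> omega z w.
Proof.
by move=> FF fz gw; apply: cvg_dot gw;
   apply: (@cvg_comp _ _ _ f rot90 _ _ _ fz); exact: rot90_continuous.
Qed.

Lemma has_deriv_on_dot a b (f g : R -> Plane R n) s l m :
  has_deriv_on a b f s l -> has_deriv_on a b g s m ->
  has_deriv_on a b (fun r => dot (f r) (g r)) s (dot l (g s) + dot (f s) m).
Proof.
move=> fl gm; rewrite /has_deriv_on (_ : diff_quot _ _ =
  fun u => dot (diff_quot f s u) (g u) + dot (f s) (diff_quot g s u)).
  apply: cvgD; apply: cvg_dot => //; last exact: cvg_cst.
  exact: has_deriv_on_cvg gm.
apply/funext => u; rewrite /diff_quot dotZl dotZr -mulrDr; congr (_ * _).
rewrite -[- f s]scaleN1r -[- g s]scaleN1r dotDl dotDr dotZl dotZr.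
by ring.
Qed.

Lemma has_deriv_on_omega a b (f g : R -> Plane R n) s l m :
  has_deriv_on a b f s l -> has_deriv_on a b g s m ->
  has_deriv_on a b (fun r => omega (f r) (g r)) s (omega l (g s) + omega (f s) m).
Proof.
move=> fl; apply: has_deriv_on_dot.
exact: has_deriv_on_comp_linear rot90_is_linear rot90_continuous fl.
Qed.

Lemma smooth_on_dot a b (f g : R -> Plane R n) : a < b ->
  smooth_on a b f -> smooth_on a b g -> smooth_on a b (fun r => dot (f r) (g r)).
Proof.
move=> ab sf sg k; elim: k f g sf sg => [|k IH] f g sf sg.
  by move=> s; apply: cvg_dot; [exact: (sf 0%N)|exact: (sg 0%N)].
apply: (Ck_onS ab (f' := fun r => dot (deriv_on a b f r) (g r)
    + dot (f r) (deriv_on a b g r))).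
  by move=> s sab; apply: has_deriv_on_dot; apply: smooth_on_has_deriv_on.
by apply: Ck_onD => //; apply: IH => //; apply: smooth_on_deriv_on.
Qed.

Lemma smooth_on_comp_linear (V W : normedModType R) a b (phi : V -> W)
    (f : R -> V) : a < b -> linear phi -> continuous phi ->
  smooth_on a b f -> smooth_on a b (fun r => phi (f r)).
Proof. by move=> ab pl pc sf k; exact: Ck_on_comp_linear. Qed.

Lemma smooth_on_omega a b (f g : R -> Plane R n) : a < b ->
  smooth_on a b f -> smooth_on a b g ->
  smooth_on a b (fun r => omega (f r) (g r)).
Proof.
move=> ab sf; apply: smooth_on_dot => //.
exact: smooth_on_comp_linear ab rot90_is_linear rot90_continuous sf.
Qed.

End HorizontalPlane.

(** * Horizontal curves and the Carnot-Caratheodory distance *)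

Section HeisenbergCurves.
Context {R : realType} {n : nat}.
Implicit Types (p q u v : Heis R n) (E : set (Heis R n)).

(** Along a curve this is a differential equation for the height, which recovers
   a horizontal curve from its projection and its initial height. *)
Lemma horizontalP q v : horizontal q v <-> v.2 = omega v.1 q.1.
Proof.
have frame0 (a b : 'rV[R]_n) :
    \sum_i a 0 i *: vX i q + \sum_i b 0 i *: vY i q = frame q (a, b, 0).
  by rewrite /frame /= scale0r addr0.
split=> [[a [b]]|h].
  by rewrite frame0 => ->; rewrite frameE /= /ht /= add0r omegaE.
exists v.1.1, v.1.2; rewrite frame0 frameE /hx /hy /ht /= add0r.
by rewrite -omegaE -h -surjective_pairing -surjective_pairing.
Qed.

(** The last product is that of the T-components, which vanish on horizontal
   vectors. *)
Lemma innerE q u v : inner q u v =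
  dot u.1 v.1 + (u.2 - omega u.1 q.1) * (v.2 - omega v.1 q.1).
Proof. by rewrite !omegaE /inner /dot big_split. Qed.

Lemma inner_horizontal q u v : horizontal q v -> inner q u v = dot u.1 v.1.
Proof. by move/horizontalP => h; rewrite innerE h subrr mulr0 addr0. Qed.

Lemma inner_vT q v : inner q v (vT q) = v.2 - omega v.1 q.1.
Proof.
rewrite innerE; have -> : (vT q).1 = 0 by [].
by rewrite [omega 0 _]omegaC /omega !dot0r oppr0 subr0 add0r mulr1.
Qed.

Lemma J_fst q v : (J q v).1 = rot90 v.1.
Proof.
have -> : J q v = frame q (- hy v, hx v, 0).
  rewrite /J /frame /= scale0r addr0 addrC -sumrN; congr (_ + _).
  by apply: eq_bigr => i _; rewrite mxE scaleNr.
by rewrite frameE.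
Qed.

Lemma has_deriv_on_pair (V W : normedModType R) a b (f : R -> V) (g : R -> W)
    s l m : has_deriv_on a b f s l -> has_deriv_on a b g s m ->
  has_deriv_on a b (fun r => (f r, g r)) s (l, m).
Proof. by move=> fl gm; exact: (cvg_pair fl gm). Qed.

Lemma smooth_on_pair (V W : normedModType R) a b (f : R -> V) (g : R -> W) :
  a < b -> smooth_on a b f -> smooth_on a b g ->
  smooth_on a b (fun r => (f r, g r)).
Proof.
move=> ab sf sg k; elim: k f g sf sg => [|k IH] f g sf sg.
  by move=> s; exact: (cvg_pair (sf 0%N s) (sg 0%N s)).
apply: (Ck_onS ab (f' := fun r => (deriv_on a b f r, deriv_on a b g r))).
  by move=> s sab; apply: has_deriv_on_pair; exact: smooth_on_has_deriv_on.
by apply: IH; exact: smooth_on_deriv_on.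
Qed.

Lemma curve_length_ge0 a b (f : R -> Heis R n) : 0 <= curve_length a b f.
Proof. by apply: Rintegral_ge0 => s _; exact: sqrtr_ge0. Qed.

Lemma cc_dist_le_length a b (f : R -> Heis R n) : a < b ->
  piecewise_smooth_horizontal a b f -> cc_dist (f a) (f b) <= curve_length a b f.
Proof.
move=> ab hf; apply: ge_inf; last by exists a, b, f.
by exists 0 => _ [a' [b' [f' [_ _ _ _ ->]]]]; exact: curve_length_ge0.
Qed.

Lemma cc_dist_ge0 p q : 0 <= cc_dist p q.
Proof.
rewrite /cc_dist; set L := [set l | _].
have [->|/set0P L0] := eqVneq L set0; first by rewrite inf0.
by apply: lb_le_inf L0 _ => _ [a [b [f [_ _ _ _ ->]]]]; exact: curve_length_ge0.
Qed.

Lemma dist_to_le E p q : E q -> dist_to E p <= cc_dist p q.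
Proof.
move=> Eq; apply: ge_inf; last by exists q.
by exists 0 => _ [y _ <-]; exact: cc_dist_ge0.
Qed.

(** The length of a horizontal curve only sees its planar projection [z], so
   it is the total increase of a primitive of the planar speed, and a larger
   derivative gives a larger increase. *)
Lemma cc_dist_lift_le a b (z z' : R -> Plane R n) (t B B' : R -> R) : a < b ->
  smooth_on a b z -> smooth_on a b t ->
  (forall s, s \in `[a, b] -> has_deriv_on a b z s (z' s)) ->
  (forall s, s \in `[a, b] -> has_deriv_on a b t s (omega (z' s) (z s))) ->
  (forall s, s \in `[a, b] -> has_deriv_on a b B s (B' s)) ->
  (forall s, s \in `[a, b] -> Num.sqrt (dot (z' s) (z' s)) <= B' s) ->
  cc_dist (z a, t a) (z b, t b) <= B b - B a.
Proof.
move=> ab sz st dz dt dB le_B; pose f r : Heis R n := (z r, t r).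
have sf : smooth_on a b f by exact: smooth_on_pair.
have df s : s \in `[a, b] -> deriv_on a b f s = (z' s, omega (z' s) (z s)).
  by move=> sab; apply: (deriv_onE ab sab); apply: has_deriv_on_pair; auto.
have hf s : s \in `[a, b] -> horizontal (f s) (deriv_on a b f s).
  by move=> sab; rewrite df //; apply/horizontalP.
have speed s : s \in `[a, b] ->
    Num.sqrt (dot (deriv_on a b z s) (deriv_on a b z s)) =
    riem_norm (f s) (deriv_on a b f s).
  move=> sab; rewrite /riem_norm (inner_horizontal _ (hf s sab)) df //=.
  by rewrite (deriv_onE ab sab (dz s sab)).
have cspeed : {within `[a, b], continuous
    (fun s => riem_norm (f s) (deriv_on a b f s))}.
  apply: (@subspace_eq_continuous _ _ _
    (fun s => Num.sqrt (dot (deriv_on a b z s) (deriv_on a b z s)))).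
    by move=> s; rewrite inE => /speed.
  move=> s; apply: continuous_comp; last exact: sqrt_continuous.
  have sz' : smooth_on a b (deriv_on a b z) by exact: smooth_on_deriv_on.
  exact: (smooth_on_dot ab sz' sz' 0).
have [F Fa dF] := antiderivative_ex ab cspeed.
have -> : (z a, t a) = f a by []. have -> : (z b, t b) = f b by [].
apply: (le_trans (y := curve_length a b f)).
  apply: cc_dist_le_length => //; split; first exact: (sf 0%N).
  by exists [:: b]; split => //= [|[|//] _ /=]; rewrite ?ab.
rewrite /curve_length (has_deriv_on_Rintegral ab cspeed dF).
apply: (has_deriv_on_le ab dF dB) => s sab; rewrite -speed //.
by rewrite (deriv_onE ab sab (dz s sab)) le_B.
Qed.

End HeisenbergCurves.

(** * Perturbation of a geodesic *)

Section Variation.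
Context {R : realType} {n : nat}.

Lemma has_deriv_on_mulc (a b c : R) (f : R -> R) s l :
  has_deriv_on a b f s l -> has_deriv_on a b (fun r => c * f r) s (c * l).
Proof.
move=> fl; have -> : c * l = 0 * f s + c * l by rewrite mul0r add0r.
by apply: has_deriv_onM fl; exact: has_deriv_on_cst.
Qed.

Lemma has_deriv_on_scalev (V : normedModType R) (a b : R) (k : R -> R) (v : V) s c :
  has_deriv_on a b k s c -> has_deriv_on a b (fun r => k r *: v) s (c *: v).
Proof.
move=> kc; have -> : c *: v = c *: v + k s *: 0 by rewrite scaler0 addr0.
by apply: has_deriv_onZ kc _; exact: has_deriv_on_cst.
Qed.

Lemma row_antiderivative_ex (a b : R) (f : R -> 'rV[R]_n) : a < b ->
  {within `[a, b], continuous f} ->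
  exists2 F, F a = 0 & forall s, s \in `[a, b] -> has_deriv_on a b F s (f s).
Proof.
move=> ab cf.
have /choice[F HF] i : exists F : R -> R, F a = 0 /\
    forall s, s \in `[a, b] -> has_deriv_on a b F s (f s 0 i).
  have cfi : {within `[a, b], continuous (fun s => f s 0 i)}.
    move=> s; apply: (@continuous_comp _ _ _ _ (fun M : 'rV[R]_n => M 0 i)).
      exact: cf.
    exact: coord_continuous.
  by have [G] := antiderivative_ex ab cfi; exists G.
exists (fun r => \sum_i F i r *: delta_mx 0 i).
  by rewrite big1 // => i _; rewrite (HF i).1 scale0r.
move=> s sab; rewrite [f s]row_sum_delta; apply: has_deriv_on_sum => i.
by apply: has_deriv_on_scalev; exact: (HF i).2.
Qed.

(** The primitive has to be taken of a vector, and not of its pairing with a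
   given [a], in order that the final height be linear in [a]. *)
Lemma plane_antiderivative_ex (a b : R) (f : R -> Plane R n) : a < b ->
  {within `[a, b], continuous f} ->
  exists2 F, F a = 0 & forall s, s \in `[a, b] -> has_deriv_on a b F s (f s).
Proof.
move=> ab cf.
have c1 : {within `[a, b], continuous (fun s => (f s).1)}.
  by move=> s; apply: continuous_comp; [exact: cf|exact: fst_continuous].
have c2 : {within `[a, b], continuous (fun s => (f s).2)}.
  by move=> s; apply: continuous_comp; [exact: cf|exact: snd_continuous].
have [F Fa dF] := row_antiderivative_ex ab c1.
have [G Ga dG] := row_antiderivative_ex ab c2.
exists (fun r => (F r, G r)) => [|s sab]; first by rewrite Fa Ga.
by rewrite [f s]surjective_pairing; apply: has_deriv_on_pair; auto.
Qed.

(** The graph of the square root lies below its tangent at [1]. *)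
Lemma sqrt_le_mean (x : R) : 0 <= x -> Num.sqrt x <= (1 + x) / 2.
Proof.
by move=> x0; have := sqr_ge0 (Num.sqrt x - 1); have := sqr_sqrtr x0; nra.
Qed.

(** Here [z] is the projection of a unit speed geodesic from [p] to [q], and the
   end point of the competitor depends on the displacement [a] and the parameter
   [b]. The constants are [P], the integral of [(r / d) z' r]; [S], that of
   [e omega (z', u)]; [M], that of [e / d]; and [N], that of [e' ^ 2]. The
   competitor and the bound on its length share the combination
   [omega P a + b S], half of the first order change of the final height
   measured along the horizontal direction [a]: eliminating it leaves [lambda]
   multiplied by that change. *)
Lemma cc_dist_variation (d lambda : R) (z z' : R -> Plane R n) (t : R -> R) :
  0 < d -> smooth_on 0 d z -> smooth_on 0 d z' ->
  (forall s, s \in `[0, d] -> has_deriv_on 0 d z s (z' s)) ->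
  (forall s, s \in `[0, d] -> has_deriv_on 0 d z' s (lambda *: rot90 (z' s))) ->
  (forall s, s \in `[0, d] -> has_deriv_on 0 d t s (omega (z' s) (z s))) ->
  (forall s, s \in `[0, d] -> dot (z' s) (z' s) = 1) ->
  exists (P u : Plane R n) (S M N : R), 0 < S /\ forall (a : Plane R n) (b : R),
    cc_dist (z 0, t 0)
      (z d + a, t d + omega a (z d) + 2 * (omega P a + b * S)
                + 2 * (b * omega a u * M)) <=
    d + dot (z' d) a - lambda * (omega P a + b * S)
      + dot a a / (2 * d) + b ^+ 2 * dot u u * N / 2.
Proof.
move=> d0 sz sz' dz dz' dt unit.
have d_neq0 : d != 0 by rewrite gt_eqF.
pose phi (r : R) := d^-1 * r.
have dphi s : has_deriv_on 0 d phi s d^-1.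
  by rewrite -[X in has_deriv_on _ _ _ _ X]mulr1; apply: has_deriv_on_mulc;
     exact: has_deriv_on_id.
have sphi : smooth_on 0 d phi.
  by apply: smooth_onM => //; [exact: smooth_on_cst|move=> k; exact: Ck_on_id].
have sid : smooth_on 0 d (fun r : R => r) by move=> k; exact: Ck_on_id.
have mid : d / 2 \in `[0, d] by rewrite in_itv /=; apply/andP; split; lra.
(* This choice makes omega (z' r) u equal to 1 at the middle of the segment. *)
pose u := rot90 (z' (d / 2)).
have s_omega v : smooth_on 0 d (fun r => omega (z' r) v).
  by apply: smooth_on_omega => //; exact: smooth_on_cst.
have sopp : smooth_on 0 d (fun r : R => - r).
  rewrite (_ : (fun r => - r) = fun r => (-1) * r).
    by apply: smooth_onM => //; exact: smooth_on_cst.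
  by apply/funext => r; rewrite mulN1r.
pose e (r : R) := r * (d - r) * omega (z' r) u.
have se : smooth_on 0 d e.
  apply: smooth_onM => //; apply: smooth_onM => //.
  apply: smooth_onD => //; first exact: smooth_on_cst.
pose e' := deriv_on 0 d e.
have se' : smooth_on 0 d e' by exact: smooth_on_deriv_on.
have de s : s \in `[0, d] -> has_deriv_on 0 d e s (e' s).
  exact: smooth_on_has_deriv_on.
have e0 : e 0 = 0 by rewrite /e !mul0r.
have ed : e d = 0 by rewrite /e subrr mulr0 mul0r.
have [P P0 dP] : exists2 P : R -> Plane R n, P 0 = 0 &
    forall s, s \in `[0, d] -> has_deriv_on 0 d P s (phi s *: z' s).
  by apply: plane_antiderivative_ex => //; exact: (smooth_onZ d0 sphi sz' 0).
have [S S0 dS] := antiderivative_ex d0 (smooth_onM d0 se (s_omega u) 0).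
have [M M0 dM] := antiderivative_ex d0 (smooth_onM d0 (smooth_on_cst d0 d^-1) se 0).
have [N N0 dN] := antiderivative_ex d0 (smooth_onM d0 se' se' 0).
have SE r : e r * omega (z' r) u = r * (d - r) * omega (z' r) u ^+ 2.
  by rewrite /e; ring.
exists (P d), u, (S d), (M d), (N d); split.
  rewrite -S0; apply: (has_deriv_on_lt d0 dS _ mid) => [s|].
    rewrite in_itv /= SE => /andP[s0 sd].
    by rewrite mulr_ge0 ?sqr_ge0 // mulr_ge0 // subr_ge0.
  by rewrite SE omega_rot90 unit //; nra.
move=> a b.
pose h r := phi r *: a + (b * e r) *: u.
pose h' r := d^-1 *: a + (b * e' r) *: u.
have dh s : s \in `[0, d] -> has_deriv_on 0 d h s (h' s).
  move=> sd; apply: has_deriv_onD; apply: has_deriv_on_scalev => //.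
  by apply: has_deriv_on_mulc; exact: de.
have sh : smooth_on 0 d h.
  apply: smooth_onD => //; apply: smooth_onZ => //; try exact: smooth_on_cst.
  by apply: smooth_onM => //; exact: smooth_on_cst.
pose zv r := z r + h r.
pose zv' r := z' r + h' r.
have szv : smooth_on 0 d zv by exact: smooth_onD.
have dzv s : s \in `[0, d] -> has_deriv_on 0 d zv s (zv' s).
  by move=> sd; apply: has_deriv_onD; [exact: dz|exact: dh].
(* Integrating omega (h', z) by parts turns it into omega (h, z) plus a second
   copy of the integral of omega (z', h), whence the factor 2; the last term is a
   primitive of omega (h', h). *)
pose tv r := t r + omega (h r) (z r) + 2 * (omega (P r) a + b * S r)
  + (b * omega a u) * (2 * M r + (-1) * (phi r * e r)).
have dtv s : s \in `[0, d] -> has_deriv_on 0 d tv s (omega (zv' s) (zv s)).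
  move=> sd.
  have -> : omega (zv' s) (zv s) =
      omega (z' s) (z s) + (omega (h' s) (z s) + omega (h s) (z' s))
      + 2 * ((omega (phi s *: z' s) a + omega (P s) 0)
             + b * (e s * omega (z' s) u))
      + (b * omega a u) * (2 * (d^-1 * e s)
             + (-1) * (d^-1 * e s + phi s * e' s)).
    have -> : omega (P s) 0 = 0 by rewrite /omega dot0r.
    rewrite /zv /zv' /h /h' !(omegaDl, omegaDr, omegaZl, omegaZr) !omega_self.
    rewrite (omegaC u a) (omegaC a (z' s)) (omegaC u (z' s)).
    by ring.
  apply: has_deriv_onD; last first.
    apply: has_deriv_on_mulc; apply: has_deriv_onD; apply: has_deriv_on_mulc.
      exact: dM.
    by apply: has_deriv_onM => //; exact: de.
  apply: has_deriv_onD; last first.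
    apply: has_deriv_on_mulc; apply: has_deriv_onD.
      by apply: has_deriv_on_omega; [exact: dP|exact: has_deriv_on_cst].
    by apply: has_deriv_on_mulc; exact: dS.
  apply: has_deriv_onD; first exact: dt.
  by apply: has_deriv_on_omega; [exact: dh|exact: dz].
have stv : smooth_on 0 d tv.
  apply: (smooth_onS d0 (f' := fun r => omega (deriv_on 0 d zv r) (zv r))).
    by move=> s sd; rewrite (deriv_onE d0 sd (dzv s sd)); exact: dtv.
  by apply: smooth_on_omega => //; exact: smooth_on_deriv_on.
(* A primitive of the mean of 1 and the squared speed; the geodesic equation
   enters through the two terms with lambda, which come from integrating by parts
   the pairing of z' with h'. *)
pose B r := r + phi r * dot (z' r) a + (- lambda) * omega (P r) a
  + b * (e r * dot (z' r) u) + (- lambda * b) * S r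
  + (dot a a / (2 * d ^+ 2)) * r + (b / d * dot a u) * e r
  + (b ^+ 2 * dot u u / 2) * N r.
have dB s : s \in `[0, d] ->
    has_deriv_on 0 d B s ((1 + dot (zv' s) (zv' s)) / 2).
  move=> sd.
  have -> : (1 + dot (zv' s) (zv' s)) / 2 =
      1 + (d^-1 * dot (z' s) a
           + phi s * (dot (lambda *: rot90 (z' s)) a + dot (z' s) 0))
      + (- lambda) * (omega (phi s *: z' s) a + omega (P s) 0)
      + b * (e' s * dot (z' s) u
           + e s * (dot (lambda *: rot90 (z' s)) u + dot (z' s) 0))
      + (- lambda * b) * (e s * omega (z' s) u)
      + (dot a a / (2 * d ^+ 2)) * 1 + (b / d * dot a u) * e' s
      + (b ^+ 2 * dot u u / 2) * (e' s * e' s).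
    have -> : omega (P s) 0 = 0 by rewrite /omega dot0r.
    rewrite omegaZl /omega !dot0r /zv' /h' !(dotDl, dotDr, dotZl, dotZr) unit //.
    rewrite (dotC a (z' s)) (dotC u (z' s)) (dotC u a).
    by field.
  have dz'v v : has_deriv_on 0 d (fun r => dot (z' r) v) s
      (dot (lambda *: rot90 (z' s)) v + dot (z' s) 0).
    by apply: has_deriv_on_dot; [exact: dz'|exact: has_deriv_on_cst].
  apply: has_deriv_onD; last by apply: has_deriv_on_mulc; exact: dN.
  apply: has_deriv_onD; last by apply: has_deriv_on_mulc; exact: de.
  apply: has_deriv_onD; last by apply: has_deriv_on_mulc; exact: has_deriv_on_id.
  apply: has_deriv_onD; last by apply: has_deriv_on_mulc; exact: dS.
  apply: has_deriv_onD; last first.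
    by apply: has_deriv_on_mulc; apply: has_deriv_onM; [exact: de|exact: dz'v].
  apply: has_deriv_onD; last first.
    apply: has_deriv_on_mulc.
    by apply: has_deriv_on_omega; [exact: dP|exact: has_deriv_on_cst].
  apply: has_deriv_onD; first exact: has_deriv_on_id.
  by apply: has_deriv_onM; [exact: dphi|exact: dz'v].
have := cc_dist_lift_le d0 szv stv dzv dtv dB
  (fun s sd => sqrt_le_mean (dot_ge0 (zv' s))).
have phi0 : phi 0 = 0 by rewrite /phi mulr0.
have phid : phi d = 1 by rewrite /phi mulVf.
have h0 : h 0 = 0 by rewrite /h phi0 e0 mulr0 !scale0r addr0.
have hd : h d = a by rewrite /h phid ed mulr0 scale0r scale1r addr0.
have o0 v : omega 0 v = 0 by rewrite omegaC /omega dot0r oppr0.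
rewrite /zv /tv h0 hd P0 S0 M0 phi0 e0 !o0 phid ed.
rewrite !(mulr0, mul0r, addr0, mul1r).
set A := (z d + a, _); set A' := (z d + a, _).
have -> : A = A' by rewrite /A /A'; congr (_, _); ring.
move/le_trans; apply.
rewrite /B P0 S0 N0 phi0 e0 phid ed o0 !(mulr0, mul0r, addr0, mul1r) subr0.
by rewrite le_eqVlt; apply/orP; left; apply/eqP; field.
Qed.

End Variation.

(** * The first variation inequality *)

Section FirstVariation.
Context {R : realType} {n : nat}.
Implicit Types (p q v : Heis R n) (E : set (Heis R n)).

Lemma linear_fst (U V : lmodType R) : linear (@fst U V).
Proof. by []. Qed.

Lemma linear_snd (U V : lmodType R) : linear (@snd U V).
Proof. by []. Qed.

(** In the frame, the velocity of a horizontal curve has the coordinates of its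
   projection, so the covariant derivative is the second derivative of the
   projection. *)
Lemma geodesic_projection (lambda d : R) (gamma : R -> Heis R n) s : 0 < d ->
  geodesic lambda 0 d gamma -> s \in `[0, d] ->
  (deriv_on 0 d (deriv_on 0 d gamma) s).1
    = - (lambda *: rot90 (deriv_on 0 d gamma s).1).
Proof.
move=> d0 [sg Hg] sd; have [_ _] := Hg s sd.
rewrite /cov_deriv; set V := deriv_on 0 d gamma.
pose proj (v : Heis R n) : Heis R n := (v.1, 0).
have projl : linear proj.
  by move=> c v w; apply: injective_projections; rewrite //= scaler0 addr0.
have projc : continuous proj.
  move=> v; have h1 : (fun w : Heis R n => w.1) @ v --> v.1 by exact: cvg_fst.
  have h2 : (fun w : Heis R n => 0 : R) @ v --> (0 : R) by exact: cvg_cst.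
  exact: (cvg_pair h1 h2).
have dV : has_deriv_on 0 d V s (deriv_on 0 d V s).
  by apply: smooth_on_has_deriv_on => //; exact: smooth_on_deriv_on.
have projE r : r \in `[0, d] -> proj (V r) = coframe (gamma r) (V r).
  move=> rd; have [/horizontalP hr _ _] := Hg r rd.
  by rewrite /coframe -omegaE /ht hr subrr; apply: injective_projections => //;
     rewrite /= -surjective_pairing.
have /(deriv_onE d0 sd) -> := eq_has_deriv_on sd projE
  (has_deriv_on_comp_linear projl projc dV).
rewrite frameE => /(congr1 fst) H.
have {H} : (deriv_on 0 d V s).1 + lambda *: (J (gamma s) (V s)).1 = 0.
  by rewrite [X in X + _]surjective_pairing.
by rewrite J_fst => /eqP; rewrite addr_eq0 => /eqP.
Qed.

(** If all the competitors reaching the points [f s] have a nonnegative excess,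
   then the first order part of the excess along [f] is nonnegative. The end point
   condition is solved for [b] by dividing the change of height by
   [2 (S + M omega a u)], which is positive for small [s] as [a] tends to [0]; and
   [b] is of the order of [s], so the quadratic terms disappear in the limit. *)
Lemma first_variation_limit (eps d lambda S M N : R) (P u c : Plane R n)
    (f : R -> Heis R n) v :
  0 < eps -> 0 < S -> has_deriv_on 0 eps f 0 v ->
  (forall s a b, s \in `[0, eps] ->
    f s = ((f 0).1 + a, (f 0).2 + omega a (f 0).1 + 2 * (omega P a + b * S)
                        + 2 * (b * omega a u * M)) ->
    0 <= dot c a - lambda * (omega P a + b * S)
         + dot a a / (2 * d) + b ^+ 2 * dot u u * N / 2) ->
  0 <= dot c v.1 - lambda / 2 * (v.2 - omega v.1 (f 0).1).
Proof.
move=> eps0 S0 df var; set q := f 0 in var *.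
have e0in : 0 \in `[0, eps] by rewrite in_itv /= lexx ltW.
pose F := within `[0, eps] (0 : R)^'.
have PF : ProperFilter F by exact: within_itv_proper eps0 _ e0in.
(* a = s A s, b = s beta s, and s T s is the change of height of f relative to
   the horizontal lift. *)
pose A s : Plane R n := s^-1 *: ((f s).1 - q.1).
pose T s : R := s^-1 * ((f s).2 - q.2) - omega (A s) q.1.
have cA : A @ F --> v.1.
  have := has_deriv_on_comp_linear (@linear_fst _ _) (@fst_continuous _ _) df.
  rewrite /has_deriv_on (_ : diff_quot _ _ = A); first by [].
  by apply/funext => s; rewrite /diff_quot subr0.
have cT : T @ F --> v.2 - omega v.1 q.1.
  apply: cvgB; last by apply: cvg_omega cA _; exact: cvg_cst.
  have := has_deriv_on_comp_linear (@linear_snd _ _) (@snd_continuous _ _) df.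
  rewrite /has_deriv_on (_ : diff_quot _ _ = fun s => s^-1 * ((f s).2 - q.2)).
    by [].
  by apply/funext => s; rewrite /diff_quot subr0.
have cs : (fun s : R => s) @ F --> (0 : R) by exact: within_cvg_id.
have ca : (fun s => s *: A s) @ F --> (0 : Plane R n).
  by rewrite -(scale0r v.1); exact: cvgZ cs cA.
pose D s := S + M * omega (s *: A s) u.
have cD : D @ F --> S.
  rewrite -[X in _ --> X]addr0; apply: cvgD; first exact: cvg_cst.
  rewrite -(mulr0 M); apply: cvgM; first exact: cvg_cst.
  have <- : omega (0 : Plane R n) u = 0 by rewrite omegaC /omega dot0r oppr0.
  by apply: cvg_omega ca _; exact: cvg_cst.
pose beta s := (T s - 2 * omega P (A s)) * (2 * D s)^-1.
pose b0 := (v.2 - omega v.1 q.1 - 2 * omega P v.1) * (2 * S)^-1.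
have cb : beta @ F --> b0.
  apply: cvgM; last first.
    by apply: cvgV; [rewrite mulf_neq0 ?gt_eqF|apply: cvgM cD; exact: cvg_cst].
  apply: cvgB; first exact: cT.
  apply: cvgM; first exact: cvg_cst.
  by apply: cvg_omega cA; exact: cvg_cst.
pose G s := dot c (A s) - lambda / 2 * T s
  + s * (lambda * M * (beta s * omega (A s) u) + (2 * d)^-1 * dot (A s) (A s)
         + (dot u u * N / 2) * (beta s * beta s)).
have cG : G @ F --> dot c v.1 - lambda / 2 * (v.2 - omega v.1 q.1) + 0.
  apply: cvgD.
    apply: cvgB; first by apply: cvg_dot cA; exact: cvg_cst.
    by apply: cvgM cT; exact: cvg_cst.
  rewrite -(mul0r (lambda * M * (b0 * omega v.1 u) + (2 * d)^-1 * dot v.1 v.1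
         + (dot u u * N / 2) * (b0 * b0))).
  apply: cvgM; first exact: cs.
  apply: cvgD.
    apply: cvgD; apply: cvgM.
    - exact: cvg_cst.
    - by apply: cvgM; [exact: cb|apply: cvg_omega cA _; exact: cvg_cst].
    - exact: cvg_cst.
    - by apply: cvg_dot; exact: cA.
  by apply: cvgM; [exact: cvg_cst|apply: cvgM; exact: cb].
have Dpos : \forall s \near F, 0 < D s by exact: (cvgr_gt _ cD).
have spos : \forall s \near F, s \in `[0, eps] /\ 0 < s.
  apply: within_itvW => s seps s_neq0; split; first exact: seps.
  by move: seps; rewrite in_itv /= lt_neqAle eq_sym s_neq0 => /andP[].
have Gpos : \forall s \near F, 0 <= G s.
  apply: filterS2 Dpos spos => s Ds [seps s0].
  have s_neq0 : s != 0 by rewrite gt_eqF.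
  have aE : (f s).1 = q.1 + s *: A s.
    by rewrite /A scalerA divff // scale1r addrC subrK.
  have tE : (f s).2 = q.2 + omega (s *: A s) q.1 + s * T s.
    by rewrite /T (omegaZl s); field.
  have bD : T s = 2 * omega P (A s) + beta s * (2 * D s).
    by rewrite /beta mulfVK ?mulf_neq0 ?gt_eqF // addrC subrK.
  have fE : f s = (q.1 + s *: A s, q.2 + omega (s *: A s) q.1
      + 2 * (omega P (s *: A s) + s * beta s * S)
      + 2 * (s * beta s * omega (s *: A s) u * M)).
    rewrite [f s]surjective_pairing aE tE; congr (_, _).
    rewrite -!addrA; congr (_ + (_ + _)).
    by rewrite bD /D (omegaZr s) (omegaZl s); ring.
  have {var fE} := var s (s *: A s) (s * beta s) seps fE.
  suff -> : dot c (s *: A s) - lambda * (omega P (s *: A s) + s * beta s * S)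
      + dot (s *: A s) (s *: A s) / (2 * d)
      + (s * beta s) ^+ 2 * dot u u * N / 2 = s * G s.
    by rewrite pmulr_rge0.
  have -> : omega P (s *: A s) + s * beta s * S =
      s * (T s / 2 - M * (beta s * omega (s *: A s) u)).
    by rewrite bD /D (omegaZr s) (omegaZl s); field.
  rewrite /G !(dotZl s, dotZr s, omegaZl s).
  by move: (2 * d)^-1 => k; field.
have limG := cvg_lim (@Rhausdorff R) cG.
have cvgG : cvg (G @ F) by apply/cvg_ex; eexists; exact: cG.
have := limr_ge cvgG Gpos.
by rewrite limG addr0; apply.
Qed.

(** The geodesic is run backwards because [cc_dist p] is the length of curves that
   leave [p]; this changes the sign of the curvature and of the velocity at [q]. *)
Lemma geodesic_variation p q (gamma : R -> Heis R n) (lambda d : R) :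
  0 < d -> geodesic lambda 0 d gamma -> gamma 0 = q -> gamma d = p ->
  exists (P u : Plane R n) (S M N : R), 0 < S /\ forall (a : Plane R n) (b : R),
    cc_dist p
      (q.1 + a, q.2 + omega a q.1 + 2 * (omega P a + b * S)
                + 2 * (b * omega a u * M)) <=
    d + dot ((-1) *: (deriv_on 0 d gamma 0).1) a - lambda * (omega P a + b * S)
      + dot a a / (2 * d) + b ^+ 2 * dot u u * N / 2.
Proof.
move=> d0 geo g0 gd.
have [sg Hg] := geo; set V := deriv_on 0 d gamma.
have sV : smooth_on 0 d V by exact: smooth_on_deriv_on.
have refl s : s \in `[0, d] -> 0 + d - s \in `[0, d] by exact: itv_reflect.
pose z r := (gamma (0 + d - r)).1.
pose z' r := (-1) *: (V (0 + d - r)).1.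
pose t r := (gamma (0 + d - r)).2.
have dz s : s \in `[0, d] -> has_deriv_on 0 d z s (z' s).
  move=> sd; rewrite /z' scaleN1r; apply: (has_deriv_on_reflect (f := fst \o gamma)).
  apply: has_deriv_on_comp_linear; [exact: linear_fst|exact: fst_continuous|].
  by apply: smooth_on_has_deriv_on => //; exact: refl.
have dz' s : s \in `[0, d] -> has_deriv_on 0 d z' s (lambda *: rot90 (z' s)).
  move=> sd.
  have -> : lambda *: rot90 (z' s) = (-1) *: - (deriv_on 0 d V (0 + d - s)).1.
    by rewrite (geodesic_projection d0 geo (refl s sd)) opprK /z' rot90Z
       !scalerA mulrC.
  have dc := @has_deriv_on_cst R 0 d R (-1) s.
  have dV : has_deriv_on 0 d (fun r => (V (0 + d - r)).1) s
      (- (deriv_on 0 d V (0 + d - s)).1).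
    apply: (has_deriv_on_reflect (f := fst \o V)).
    apply: has_deriv_on_comp_linear; [exact: linear_fst|exact: fst_continuous|].
    by apply: smooth_on_has_deriv_on => //; exact: refl.
  set l := (-1) *: _; have -> : l = 0 *: (V (0 + d - s)).1 + l.
    by rewrite scale0r add0r.
  exact: has_deriv_onZ dc dV.
have dt s : s \in `[0, d] -> has_deriv_on 0 d t s (omega (z' s) (z s)).
  move=> sd.
  have [/horizontalP hs _ _] := Hg _ (refl s sd).
  rewrite /z' omegaZl mulN1r -hs; apply: (has_deriv_on_reflect (f := snd \o gamma)).
  apply: has_deriv_on_comp_linear; [exact: linear_snd|exact: snd_continuous|].
  by apply: smooth_on_has_deriv_on => //; exact: refl.
have unit s : s \in `[0, d] -> dot (z' s) (z' s) = 1.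
  move=> sd; have [hs + _] := Hg _ (refl s sd).
  rewrite /riem_norm (inner_horizontal _ hs) /z' dotZl dotZr mulrA mulrNN !mul1r.
  by move=> hN; rewrite -[LHS]sqr_sqrtr ?dot_ge0 // hN expr1n.
have sz : smooth_on 0 d z.
  move=> k; apply: (Ck_on_reflect d0 (f := fst \o gamma)).
  by apply: Ck_on_comp_linear; [|exact: linear_fst|exact: fst_continuous|exact: sg].
have sz' : smooth_on 0 d z'.
  apply: smooth_onZ => //; first exact: smooth_on_cst.
  move=> k; apply: (Ck_on_reflect d0 (f := fst \o V)).
  by apply: Ck_on_comp_linear; [|exact: linear_fst|exact: fst_continuous|exact: sV].
have [zd z'd td z0 t0] : [/\ z d = q.1, z' d = (-1) *: (V 0).1, t d = q.2,
    z 0 = p.1 & t 0 = p.2].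
  by rewrite /z /z' /t add0r subrr subr0 g0 gd.
have := cc_dist_variation d0 sz sz' dz dz' dt unit.
by rewrite zd z'd td z0 t0 -surjective_pairing.
Qed.

Lemma first_variation_le E p q (gamma : R -> Heis R n) (lambda d : R) v :
  0 < d -> geodesic lambda 0 d gamma -> gamma 0 = q -> gamma d = p ->
  (forall y, E y -> d <= cc_dist p y) -> curve_tangents E q v ->
  dot v.1 (deriv_on 0 d gamma 0).1 + lambda / 2 * (v.2 - omega v.1 q.1) <= 0.
Proof.
move=> d0 geo g0 gd dist_le [eps [f [eps0 Cf f0 Ef ->]]].
set w := deriv_on 0 eps f 0.
have e0in : 0 \in `[0, eps] by rewrite in_itv /= lexx ltW.
have df : has_deriv_on 0 eps f 0 w by exact: Ck_on_has_deriv_on Cf e0in.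
have [P [u [S [M [N [S0 var]]]]]] := geodesic_variation d0 geo g0 gd.
have := @first_variation_limit eps d lambda S M N P u
  ((-1) *: (deriv_on 0 d gamma 0).1) f w eps0 S0 df.
rewrite f0 dotZl mulN1r -opprD oppr_ge0 (dotC _ w.1); apply => s a b seps fE.
have := le_trans (dist_le _ (Ef s seps)) _; rewrite fE => /(_ _ (var a b)).
by rewrite -subr_ge0; congr (0 <= _); ring.
Qed.

Lemma Tan_first_variation_le E p q (gamma : R -> Heis R n) (lambda d : R) v :
  0 < d -> geodesic lambda 0 d gamma -> gamma 0 = q -> gamma d = p ->
  (forall y, E y -> d <= cc_dist p y) -> Tan E q v ->
  dot v.1 (deriv_on 0 d gamma 0).1 + lambda / 2 * (v.2 - omega v.1 q.1) <= 0.
Proof.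
move=> d0 geo g0 gd dist_le; set w := (deriv_on 0 d gamma 0).1.
pose l (u : Heis R n) := dot u.1 w + lambda / 2 * (u.2 - omega u.1 q.1).
have cl : continuous l.
  move=> u; have c1 : (fun u : Heis R n => u.1) @ u --> u.1 by exact: cvg_fst.
  have c2 : (fun u : Heis R n => u.2) @ u --> u.2 by exact: cvg_snd.
  apply: cvgD; first by apply: cvg_dot c1 _; exact: cvg_cst.
  apply: cvgM; first exact: cvg_cst.
  by apply: cvgB c2 _; apply: cvg_omega c1 _; exact: cvg_cst.
case=> [->|cv].
  have -> : (0 : Heis R n).1 = 0 by [].
  by rewrite dotC omegaC /omega !dot0r oppr0 subr0 mulr0 addr0.
have closed_l : closed (l @^-1` [set x | x <= 0]).
  by apply: preimage_closed => [u _|]; [exact: cl|exact: closed_le].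
have : closure (curve_tangents E q) `<=` closure (l @^-1` [set x | x <= 0]).
  by apply: closureS => u; exact: first_variation_le geo g0 gd dist_le.
by move/(_ v cv); rewrite -(closure_id _).1.
Qed.

End FirstVariation.

Theorem lemma3p11 (R : realType) (n : nat) (n_ge1 : (1 <= n)%N)
    (E : set (Heis R n)) (p q : Heis R n) (gamma : R -> Heis R n) (lambda : R) :
  closed E -> ~ E p -> E q -> dist_to E p = cc_dist p q ->
  length_minimizing 0 (dist_to E p) gamma ->
  geodesic lambda 0 (dist_to E p) gamma ->
  gamma 0 = q -> gamma (dist_to E p) = p ->
  let w : Heis R n := deriv_on 0 (dist_to E p) gamma 0 in
  Nor_H E q w /\
  ((ereal_sup [set ((- 2 * inner q v w / inner q v (vT q))%R)%:E |
                 v in [set v | Tan E q v /\ (inner q v (vT q) < 0)%R]]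
      <= lambda%:E)%E /\
   (lambda%:E <=
    ereal_inf [set ((- 2 * inner q v w / inner q v (vT q))%R)%:E |
                 v in [set v | Tan E q v /\ (0 < inner q v (vT q))%R]])%E).
Proof.
move=> _ nEp Eq dpq _; set d := dist_to E p => geo g0 gd w.
have d0 : 0 < d.
  rewrite lt_neqAle {2}/d dpq cc_dist_ge0 andbT; apply/eqP => d0.
  by apply: nEp; rewrite -gd -d0 g0.
have hw : horizontal q w.
  have [_ /(_ 0)[]] := geo; first by rewrite in_itv /= lexx ltW.
  by rewrite g0.
have key v : Tan E q v -> dot v.1 w.1 + lambda / 2 * (v.2 - omega v.1 q.1) <= 0.
  by apply: Tan_first_variation_le geo g0 gd _ => // y; exact: dist_to_le.
split; first split => // v [/key + /horizontalP hv].
  by rewrite inner_horizontal ?(dotC w.1) ?hv ?subrr ?mulr0 ?addr0 //; apply/horizontalP.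
split.
- apply: ge_ereal_sup => _ [v [/key Tv + ] <-].
  rewrite inner_vT (inner_horizontal _ hw) => neg.
  by rewrite lee_fin ler_ndivrMr //; lra.
- apply: le_ereal_inf_tmp => _ [v [/key Tv + ] <-].
  rewrite inner_vT (inner_horizontal _ hw) => pos.
  by rewrite lee_fin ler_pdivlMr //; lra.
Qed.
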